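(* Let $M\in\mathbb{R}^{n\times n}$ be symmetric positive definite, and fix an eigenvalue decomposition $M=V\Sigma V^\top$, with $V$ orthogonal and $\Sigma=\operatorname{diag}(\sigma_1,\dots,\sigma_n)$. Let $\overline V\in\mathbb{R}^{n\times n}$ and the diagonal matrix $\overline\Sigma\in\mathbb{R}^{n\times n}$ be the incoming gradients of a differentiable scalar loss $\mathcal L(M)=\ell(V,\Sigma)$. Define $$K_{ij}=\begin{cases}\dfrac{1}{\sigma_i-\sigma_j}, & \sigma_i\neq\sigma_j,\\[6pt] 0, & \sigma_i=\sigma_j,\end{cases}\qquad S=\frac12\,K^\top\odot\bigl(V^\top\overline V-\overline V^\top V\bigr).$$ Then the EVD pseudo-gradient $\overline M_\star$ at this factorization (defined in the context) is given by $$\overline M_\star=V(S+\overline\Sigma)V^\top.$$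
   Context: $\langle A,B\rangle_F=\operatorname{tr}(A^\top B)$ is the Frobenius inner product, $\|\cdot\|_F$ the Frobenius norm, and $\odot$ the entrywise (Hadamard) product. The incoming gradients $\overline V,\overline\Sigma$ are the gradients of $\ell$ with respect to $V$ and $\Sigma$. Definition (EVD pseudo-gradient). Let $M=V\Sigma V^\top$ be a fixed eigendecomposition of a symmetric positive definite matrix, with incoming gradients $\overline V$ and diagonal $\overline\Sigma$. The EVD pseudo-gradient $\overline M_\star$ is the solution of the problem $$\min_{G=G^\top}\|G\|_F^2\quad\text{subject to}\quad \langle G,\mathrm dM\rangle_F=\langle\overline V,V\Omega\rangle_F+\langle\overline\Sigma,D\rangle_F$$ for every diagonal $D\in\mathbb{R}^{n\times n}$ and every skew-symmetric $\Omega\in\mathbb{R}^{n\times n}$ with $\Omega_{ij}=0$ whenever $\sigma_i=\sigma_j$. Here $\mathrm dM$ is the perturbation of $M$ induced by the factor perturbations $\mathrm dV=V\Omega$ and $\mathrm d\Sigma=D$, that is, $$\mathrm dM=\mathrm dV\,\Sigma V^\top+V\,\mathrm d\Sigma\,V^\top+V\Sigma\,\mathrm dV^\top=V(\Omega\Sigma-\Sigma\Omega+D)V^\top.$$ *)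

(* Defs.v *)
From HB Require Import structures.
From mathcomp Require Import all_boot all_order all_algebra.
From mathcomp Require Import all_classical all_reals all_analysis.

Set Implicit Arguments.
Unset Strict Implicit.
Unset Printing Implicit Defensive.

Import Order.TTheory GRing.Theory Num.Theory.
Import numFieldNormedType.Exports.
Local Open Scope ring_scope.

Definition hadamard (R : realType) (n : nat) (A B : 'M[R]_n) : 'M[R]_n :=
  map2_mx *%R A B.

Definition frob_inner (R : realType) (n : nat) (A B : 'M[R]_n) : R :=
  \tr (A^T *m B).

Definition frob_norm (R : realType) (n : nat) (A : 'M[R]_n) : R :=
  Num.sqrt (frob_inner A A).

Definition sym_posdef (R : realType) (n : nat) (M : 'M[R]_n) : Prop :=
  M^T = M /\ forall x : 'cV[R]_n, x != 0 -> 0 < (x^T *m M *m x) 0 0.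

Definition is_evd (R : realType) (n : nat) (M V : 'M[R]_n) (sigma : 'rV[R]_n) :
    Prop :=
  V^T *m V = 1%:M /\ M = V *m diag_mx sigma *m V^T.

(* The second argument of the loss only ranges over diagonal matrices, so its
   gradient is taken within that space: the loss is differentiated as a function
   of V and of the vector of diagonal entries, and Sbar is the diagonal matrix
   representing the differential in the diagonal directions. *)
Definition is_loss_gradient (R : realType) (n : nat)
    (ell : 'M[R]_n -> 'M[R]_n -> R) (V : 'M[R]_n) (sigma : 'rV[R]_n)
    (Vbar Sbar : 'M[R]_n) : Prop :=
  let f (p : 'M[R]_n * 'rV[R]_n) : R := ell p.1 (diag_mx p.2) in
  [/\ differentiable f (V, sigma), is_diag_mx Sbar &
      forall (H : 'M[R]_n) (d : 'rV[R]_n),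
        'd f (V, sigma) (H, d) =
        frob_inner Vbar H + frob_inner Sbar (diag_mx d)].

Definition evd_dM (R : realType) (n : nat) (V Sigma dV dSigma : 'M[R]_n) :
    'M[R]_n :=
  dV *m Sigma *m V^T + V *m dSigma *m V^T + V *m Sigma *m dV^T.

Definition evd_feasible (R : realType) (n : nat) (V : 'M[R]_n)
    (sigma : 'rV[R]_n) (Vbar Sbar G : 'M[R]_n) : Prop :=
  G^T = G /\
  forall D Omega : 'M[R]_n,
    is_diag_mx D ->
    Omega^T = - Omega ->
    (forall i j, sigma 0 i = sigma 0 j -> Omega i j = 0) ->
    frob_inner G (evd_dM V (diag_mx sigma) (V *m Omega) D) =
    frob_inner Vbar (V *m Omega) + frob_inner Sbar D.

Definition is_evd_pseudo_gradient (R : realType) (n : nat) (V : 'M[R]_n)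
    (sigma : 'rV[R]_n) (Vbar Sbar G : 'M[R]_n) : Prop :=
  evd_feasible V sigma Vbar Sbar G /\
  forall G' : 'M[R]_n, evd_feasible V sigma Vbar Sbar G' ->
    frob_norm G ^+ 2 <= frob_norm G' ^+ 2.

Definition evd_K (R : realType) (n : nat) (sigma : 'rV[R]_n) : 'M[R]_n :=
  \matrix_(i, j)
    if sigma 0 i == sigma 0 j then 0 else 1 / (sigma 0 i - sigma 0 j).

Definition evd_S (R : realType) (n : nat) (V : 'M[R]_n) (sigma : 'rV[R]_n)
    (Vbar : 'M[R]_n) : 'M[R]_n :=
  (1 / 2) *: hadamard (evd_K sigma)^T (V^T *m Vbar - Vbar^T *m V).

(* Main.v *)
Require Import Defs.
From HB Require Import structures.
From mathcomp Require Import all_boot all_order all_algebra.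
From mathcomp Require Import all_classical all_reals all_analysis.
From mathcomp Require Import ring.

Import Order.TTheory GRing.Theory Num.Theory.
Import numFieldNormedType.Exports.
Local Open Scope ring_scope.

(** The admissible perturbations [dM] of [M] form a linear space [T] of
    symmetric matrices, and the constraint prescribes the inner products of [G]
    with the elements of [T]. A feasible point that itself lies in [T] is then
    the orthogonal projection onto [T] of every feasible point, so by Pythagoras
    it is the unique feasible point of least norm
    ([frob_inner_pythagoras]).

    It remains to see that [Gs = V (S + Sbar) V^T] is such a point. Conjugation
    by [V] is an isometry, so everything can be read in the eigenbasis, where
    [dM] becomes [Omega Sigma - Sigma Omega + D], with entries
    [Omega_ij (sigma_j - sigma_i) + D_ij].
    - [Gs] is feasible ([evd_solution_feasible]): multiplying [S_ij] by
      [sigma_j - sigma_i] undoes the division in [K^T] wherever [Omega] may be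
      nonzero and leaves half the skew matrix [V^T Vbar - Vbar^T V], whose
      inner product with the skew matrix [Omega] is that of [V^T Vbar].
    - [Gs] lies in [T] ([evd_solution_tangent]): [S] vanishes where
      [sigma_i = sigma_j], so it is the commutator of [Sigma] with
      [K^T odot S], and [Sbar] is diagonal. *)

(** * The Frobenius inner product *)

Section Frobenius.
Context {R : realType} {n : nat}.
Implicit Types A B C V : 'M[R]_n.

Lemma frob_innerE A B : frob_inner A B = \sum_i \sum_j A i j * B i j.
Proof.
rewrite /frob_inner /mxtrace exchange_big /=; apply: eq_bigr => j _.
by rewrite mxE; apply: eq_bigr => i _; rewrite mxE.
Qed.

Lemma frob_innerC A B : frob_inner A B = frob_inner B A.
Proof. by rewrite /frob_inner -mxtrace_tr trmx_mul trmxK. Qed.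

Lemma frob_innerBl A B C :
  frob_inner (A - B) C = frob_inner A C - frob_inner B C.
Proof. by rewrite /frob_inner raddfB mulmxBl raddfB. Qed.

Lemma frob_inner_tr A B : frob_inner A^T B^T = frob_inner A B.
Proof. by rewrite /frob_inner trmxK mxtrace_mulC -mxtrace_tr trmx_mul trmxK. Qed.

Lemma frob_inner_mull V A B : frob_inner A (V *m B) = frob_inner (V^T *m A) B.
Proof. by rewrite /frob_inner trmx_mul trmxK mulmxA. Qed.

Lemma frob_inner_conj V A B : V^T *m V = 1%:M ->
  frob_inner (V *m A *m V^T) (V *m B *m V^T) = frob_inner A B.
Proof.
move=> VV; rewrite -mulmxA -(mulmxA V) frob_inner_mull mulmxA VV mul1mx.
rewrite /frob_inner trmx_mul trmxK mxtrace_mulC -mulmxA (mulmxA V^T) VV.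
by rewrite mul1mx mxtrace_mulC.
Qed.

Lemma frob_inner_ge0 A : 0 <= frob_inner A A.
Proof.
by rewrite frob_innerE; do 2![apply: sumr_ge0 => ? _]; rewrite -expr2 sqr_ge0.
Qed.

Lemma frob_inner_eq0 A : frob_inner A A = 0 -> A = 0.
Proof.
rewrite frob_innerE => /eqP; rewrite psumr_eq0 => [/allP A0|i _]; last first.
  by apply: sumr_ge0 => j _; rewrite -expr2 sqr_ge0.
apply/matrixP => i j; rewrite mxE; apply/eqP.
have := A0 i (mem_index_enum i).
rewrite psumr_eq0 /= => [/allP/(_ j (mem_index_enum j))|k _].
  by rewrite mulf_eq0 orbb.
by rewrite -expr2 sqr_ge0.
Qed.

Lemma sqr_frob_norm A : frob_norm A ^+ 2 = frob_inner A A.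
Proof. by rewrite /frob_norm sqr_sqrtr // frob_inner_ge0. Qed.

Lemma frob_inner_pythagoras A B : frob_inner A B = frob_inner B B ->
  frob_inner A A = frob_inner B B + frob_inner (A - B) (A - B).
Proof.
move=> AB; rewrite frob_innerBl !(frob_innerC _ (A - B)) !frob_innerBl.
by rewrite (frob_innerC B A) AB; ring.
Qed.

(** The symmetric part of [A] is orthogonal to every skew matrix. *)
Lemma frob_inner_skew A B : B^T = - B ->
  frob_inner (A - A^T) B = 2 * frob_inner A B.
Proof.
move=> skewB; rewrite frob_innerBl -(frob_inner_tr A^T) trmxK skewB.
by rewrite {2}/frob_inner mulmxN raddfN /= opprK mulr_natl.
Qed.

End Frobenius.

(** * Admissible perturbations in the eigenbasis *)

Section Perturbation.
Context {R : realType} {n : nat}.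
Implicit Types (D Omega V Vbar Sbar : 'M[R]_n) (sigma : 'rV[R]_n).

Definition eigen_tangent sigma Omega D : 'M[R]_n :=
  Omega *m diag_mx sigma - diag_mx sigma *m Omega + D.

Lemma eigen_tangentE sigma Omega D i j :
  eigen_tangent sigma Omega D i j
  = Omega i j * (sigma 0 j - sigma 0 i) + D i j.
Proof.
by rewrite /eigen_tangent mul_mx_diag mul_diag_mx !mxE; ring.
Qed.

Lemma evd_dM_conj sigma V Omega D : Omega^T = - Omega ->
  evd_dM V (diag_mx sigma) (V *m Omega) D
  = V *m eigen_tangent sigma Omega D *m V^T.
Proof.
move=> skewO; rewrite /evd_dM /eigen_tangent trmx_mul skewO.
rewrite !mulmxDr !mulmxDl mulmxN mulNmx mulNmx !mulmxN !mulmxA.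
by rewrite addrAC.
Qed.

Lemma evd_SE V sigma Vbar i j :
  evd_S V sigma Vbar i j
  = 1 / 2 * (evd_K sigma j i
             * (V^T *m Vbar - (V^T *m Vbar)^T) i j).
Proof. by rewrite trmx_mul trmxK !mxE. Qed.

Lemma evd_K_skew sigma i j : evd_K sigma j i = - evd_K sigma i j.
Proof.
rewrite !mxE eq_sym; case: ifP => _; first by rewrite oppr0.
by rewrite -(opprB (sigma 0 i)) invrN mulrN.
Qed.

Lemma evd_K_cancel sigma i j : sigma 0 i != sigma 0 j ->
  evd_K sigma j i * (sigma 0 j - sigma 0 i) = 1.
Proof.
by move=> ne; rewrite mxE eq_sym (negPf ne) mul1r mulVf // subr_eq0 eq_sym.
Qed.

Lemma evd_K_eq0 sigma i j : sigma 0 i = sigma 0 j -> evd_K sigma j i = 0.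
Proof. by move=> e; rewrite mxE e eqxx. Qed.

Lemma evd_S_sym V sigma Vbar : (evd_S V sigma Vbar)^T = evd_S V sigma Vbar.
Proof.
apply/matrixP => i j; rewrite [LHS]mxE !evd_SE evd_K_skew.
by move: (V^T *m Vbar) => B; rewrite !mxE; ring.
Qed.

Lemma is_diag_mx_sym D : is_diag_mx D -> D^T = D.
Proof. by case/diag_mxP => d ->; rewrite tr_diag_mx. Qed.

(** * The candidate solution *)

(** Entrywise, every cross term vanishes: [S] has zero diagonal, the commutator
    with [Sigma] too, while [D] and [Sbar] are diagonal. *)
Lemma evd_solution_inner V sigma Vbar Sbar D Omega :
  is_diag_mx Sbar -> is_diag_mx D -> Omega^T = - Omega ->
  (forall i j, sigma 0 i = sigma 0 j -> Omega i j = 0) ->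
  frob_inner (evd_S V sigma Vbar + Sbar) (eigen_tangent sigma Omega D)
  = frob_inner Vbar (V *m Omega) + frob_inner Sbar D.
Proof.
move=> /is_diag_mxP diagS /is_diag_mxP diagD skewO O0.
rewrite frob_inner_mull; set B := V^T *m Vbar.
have -> : frob_inner B Omega = 1 / 2 * frob_inner (B - B^T) Omega.
  by rewrite frob_inner_skew // mulrA mul1r mulVf ?mul1r // pnatr_eq0.
rewrite !frob_innerE mulr_sumr -big_split /=; apply: eq_bigr => i _.
rewrite mulr_sumr -big_split /=; apply: eq_bigr => j _.
rewrite mxE eigen_tangentE evd_SE -/B.
move: ((B - B^T) i j) => a.
have [eqs|nes] := eqVneq (sigma 0 i) (sigma 0 j).
  by rewrite evd_K_eq0 // O0 //; ring.
have neij : i != j by apply: contraNneq nes => ->.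
rewrite diagS // diagD //.
by rewrite -[a in RHS]mul1r -(evd_K_cancel _ _ _ nes); ring.
Qed.

Lemma evd_solution_feasible V sigma Vbar Sbar :
  V^T *m V = 1%:M -> is_diag_mx Sbar ->
  evd_feasible V sigma Vbar Sbar (V *m (evd_S V sigma Vbar + Sbar) *m V^T).
Proof.
move=> VV diagS; split.
  by rewrite !trmx_mul trmxK raddfD /= evd_S_sym is_diag_mx_sym // mulmxA.
move=> D Omega diagD skewO O0.
by rewrite evd_dM_conj // frob_inner_conj // evd_solution_inner.
Qed.

(** Dividing [S] by [sigma_j - sigma_i], with the convention [1 / 0 = 0] of [K],
    recovers the rotation [Omega] that generates it. *)
Lemma evd_solution_tangent V sigma Vbar Sbar :
  exists2 Omega : 'M[R]_n,
    Omega^T = - Omega /\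
    (forall i j, sigma 0 i = sigma 0 j -> Omega i j = 0)
    & evd_dM V (diag_mx sigma) (V *m Omega) Sbar
      = V *m (evd_S V sigma Vbar + Sbar) *m V^T.
Proof.
pose S := evd_S V sigma Vbar.
pose Omega : 'M[R]_n := \matrix_(i, j) (evd_K sigma j i * S i j).
have skewO : Omega^T = - Omega.
  apply/matrixP => i j; rewrite mxE [LHS]mxE [RHS]mxE [(Omega i j)]mxE.
  have -> : S j i = S i j by rewrite /S -[in LHS]evd_S_sym mxE.
  by rewrite evd_K_skew mulNr.
exists Omega; first by split=> // i j eqs; rewrite mxE evd_K_eq0 ?mul0r.
rewrite evd_dM_conj //; congr (_ *m _ *m _).
apply/matrixP => i j; rewrite eigen_tangentE [RHS]mxE -/S [(Omega i j)]mxE.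
congr (_ + _).
have [eqs|nes] := eqVneq (sigma 0 i) (sigma 0 j).
  by rewrite /S evd_SE evd_K_eq0 // !mul0r mulr0.
by rewrite mulrAC evd_K_cancel // mul1r.
Qed.

End Perturbation.

(** * The pseudo-gradient *)

Theorem theorem5p4 (R : realType) (n : nat) (M V : 'M[R]_n) (sigma : 'rV[R]_n)
    (ell : 'M[R]_n -> 'M[R]_n -> R) (Vbar Sbar : 'M[R]_n)
    (hM : sym_posdef M)
    (hevd : is_evd M V sigma)
    (hgrad : is_loss_gradient ell V sigma Vbar Sbar) :
  forall G : 'M[R]_n,
    is_evd_pseudo_gradient V sigma Vbar Sbar G <->
    G = V *m (evd_S V sigma Vbar + Sbar) *m V^T.
Proof.
case: hevd => VV _; case: hgrad => _ diagS _.
set Gs := V *m _ *m _.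
have feasGs : evd_feasible V sigma Vbar Sbar Gs by exact: evd_solution_feasible.
have pythagoras G : evd_feasible V sigma Vbar Sbar G ->
    frob_inner G G = frob_inner Gs Gs + frob_inner (G - Gs) (G - Gs).
  (* Gs is itself a perturbation, so the constraint prescribes the same value
     for its inner product with G and with Gs. *)
  move=> [_ feasG]; apply: frob_inner_pythagoras.
  case: (evd_solution_tangent V sigma Vbar Sbar) => Omega [skewO O0] dMGs.
  rewrite -/Gs in dMGs.
  by rewrite -{1 3}dMGs feasG // (proj2 feasGs).
move=> G; split=> [[feasG minG]|->].
  apply/eqP; rewrite -subr_eq0; apply/eqP/frob_inner_eq0/le_anti.
  rewrite frob_inner_ge0 andbT.
  have := minG _ feasGs.
  by rewrite !sqr_frob_norm (pythagoras G) // gerDl.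
split=> // G' feasG'.
by rewrite !sqr_frob_norm (pythagoras G') // lerDl frob_inner_ge0.
Qed.
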